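(* Let $(R,f,g)$ be a commutative Krasner $(m,n)$-hyperring with nonzero scalar identity $1$, and let $P$ and $Q$ be two proper hyperideals of $R$ with $Q\subseteq P$. (1) If $P$ is an $n$-ary $wsq$-primary hyperideal of $R$, then $P/Q$ is an $n$-ary $wsq$-primary hyperideal of $R/Q$. (2) If $Q$ is an $n$-ary $wsq$-primary hyperideal of $R$ and $P/Q$ is an $n$-ary $wsq$-primary hyperideal of $R/Q$, then $P$ is an $n$-ary $wsq$-primary hyperideal of $R$.
   Context: Notation: $m,n\ge 2$; $a_i^j$ denotes the sequence $a_i,a_{i+1},\dots,a_j$ (empty if $j<i$), and $a^{(k)}$ denotes $a$ repeated $k$ times. An $m$-ary hyperoperation $f$ on $R$ assigns to every $m$-tuple a nonempty subset of $R$ (a singleton is identified with its element). For nonempty subsets, $f(A_1^m)=\bigcup\{f(a_1^m): a_i\in A_i\}$ and $g(A_1^n)=\{g(a_1^n): a_i\in A_i\}$; an element $x$ in an argument stands for $\{x\}$. A canonical $m$-ary hypergroup $(R,f)$: $f$ is associative and commutative; there is a unique $0\in R$ with $f(x,0^{(m-1)})=\{x\}$ for all $x$; each $x$ has a unique $-x$ with $0\in f(x,-x,0^{(m-2)})$; and $x\in f(x_1^m)$ implies $x_i\in f(x,-x_1,\dots,-x_{i-1},-x_{i+1},\dots,-x_m)$ for each $i$. A Krasner $(m,n)$-hyperring $(R,f,g)$: $(R,f)$ is a canonical $m$-ary hypergroup, $g:R^n\to R$ is associative ($n$-ary semigroup), $g$ is distributive over $f$ in each argument, i.e. $g(a_1^{i-1},f(x_1^m),a_{i+1}^n)=f(g(a_1^{i-1},x_1,a_{i+1}^n),\dots,g(a_1^{i-1},x_m,a_{i+1}^n))$,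 and $0$ is absorbing for $g$. Commutative means $g$ is symmetric in its arguments; a scalar identity $1$ satisfies $g(x,1^{(n-1)})=x$ for all $x$. A hyperideal of $R$ is a nonempty $I\subseteq R$ that is an $m$-ary subhypergroup of $(R,f)$ (closed under $f$ and under $x\mapsto -x$) with $g(a_1^{i-1},I,a_{i+1}^n)\subseteq I$ for all $a_1^n\in R$ and all $i$. A proper hyperideal $Q$ is ($n$-ary) prime if $g(a_1^n)\in Q$ with $a_1^n\in R$ implies $a_i\in Q$ for some $i$. The radical $\mathbf{r}^{(m,n)}(I)$ of a hyperideal $I$ is the intersection of all prime hyperideals containing $I$ (equal to $R$ if there are none). For a hyperideal $Q$, the quotient Krasner $(m,n)$-hyperring $R/Q$ is the set of cosets $\bar r=f(r,Q,0^{(m-2)})$, $r\in R$, with $m$-ary hyperoperation $(\bar r_1,\dots,\bar r_m)\mapsto\{\bar t: t\in f(r_1^m)\}$ and $n$-ary operation $(\bar r_1,\dots,\bar r_n)\mapsto \overline{g(r_1^n)}$; its zero is $Q=\bar 0$ and its scalar identity is $\bar 1$. For a hyperideal $P\supseteq Q$, $P/Q=\{\bar p: p\in P\}$. A proper hyperideal $P$ of a commutative Krasner $(m,n)$-hyperring $R$ with scalar identity $1$ is $n$-ary $wsq$-primary (weakly strongly quasi-primary) if for all $r_1^n\in R$, $0\ne g(r_1^n)\in P$ implies $g(r_i^{(2)},1^{(n-2)})\in P$ or $g(r_1^{i-1},1,r_{i+1}^n)\in \mathbf{r}^{(m,n)}(P)$ for some $1\le i\le n$. *)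

(* Defs.v *)
From HB Require Import structures.
From mathcomp Require Import all_boot perm.
From mathcomp Require Import boolp classical_sets.

Set Implicit Arguments.
Unset Strict Implicit.
Unset Printing Implicit Defensive.

Local Set Warnings "-redundant-canonical-projection".

Local Open Scope classical_set_scope.

(* An argument list a_1^k is a function 'I_k -> T; positions are numbered
   from 0.  The modified list (a_1^{i-1}, x, a_{i+1}^k) is written
   [eta a with i |-> x]. *)

(* (s, z^(k - size s)) *)
Definition pad (T : Type) (k : nat) (z : T) (s : seq T) : 'I_k -> T :=
  fun i => nth z s i.

(* For a sequence x_0, x_1, ... the list (x_i, ..., x_{i+k-1}), and the list
   (x_0, ..., x_{i-1}, y, x_{i+k}, ..., x_{2k-2}) in which y replaces it. *)
Definition window (T : Type) (k : nat) (x : nat -> T) (i : nat) : 'I_k -> T :=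
  fun j => x (i + j).

Definition splice (T : Type) (k : nat) (x : nat -> T) (i : nat) (y : T) :
    'I_k -> T :=
  fun j => if j < i then x j else if j == i :> nat then y else x (j + k.-1).

Definition box (T : Type) (k : nat) (A : 'I_k -> set T) : set ('I_k -> T) :=
  [set a | forall i, A i (a i)].

(* The operations alone; the axioms are the predicates below. *)
Record hyperstruct (m n : nat) := Hyperstruct {
  carrier :> Type;
  hop : ('I_m -> carrier) -> set carrier;
  gop : ('I_n -> carrier) -> carrier;
  hzero : carrier;
  hopp : carrier -> carrier }.

Arguments hzero {m n h}.
Arguments hopp {m n h}.

Section Notions.

Variables (m n : nat) (R : hyperstruct m n).
Implicit Types (A : 'I_m -> set R) (B : 'I_n -> set R) (I P Q : set R).

Definition hopS A : set R := \bigcup_(a in box A) hop a.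

Definition gopS B : set R := @gop m n R @` box B.

(* All axioms of a canonical m-ary hypergroup except the uniqueness of the zero,
   kept apart because it need not pass to quotients: for R = Z, m = 3,
   f(x, y, z) = {x + y + z} and Q = 2Z, both elements of R/Q are neutral.  The
   other axioms do pass (quo_pre_canonical and quo_krasner_mult below). *)
Record pre_canonical_hypergroup : Prop := PreCanonicalHypergroup {
  hop_neq0 : forall x : 'I_m -> R, hop x !=set0;
  (* only x_0, ..., x_{2m-2} occur *)
  hopA : forall (x : nat -> R) (i j : 'I_m),
    hopS (splice (fun k => [set x k]) i (hop (window x i))) =
    hopS (splice (fun k => [set x k]) j (hop (window x j)));
  hopC : forall (x : 'I_m -> R) (s : {perm 'I_m}), hop (x \o s) = hop x;
  hopx0 : forall x : R, hop (pad hzero [:: x]) = [set x];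
  hopxN : forall x : R, hop (pad hzero [:: x; hopp x]) hzero;
  hopp_uniq : forall x y : R, hop (pad hzero [:: x; y]) hzero -> y = hopp x;
  hop_reversible : forall (x : 'I_m -> R) (y : R) (i : 'I_m), hop x y ->
    hop [eta (fun j => hopp (x j)) with i |-> y] (x i) }.

Definition zero_unique : Prop :=
  forall e : R, (forall x : R, hop (pad e [:: x]) = [set x]) -> e = hzero.

Definition canonical_hypergroup : Prop :=
  pre_canonical_hypergroup /\ zero_unique.

Record krasner_mult : Prop := KrasnerMult {
  gopA : forall (x : nat -> R) (i j : 'I_n),
    gop (splice x i (gop (window x i))) = gop (splice x j (gop (window x j)));
  gopD : forall (a : 'I_n -> R) (i : 'I_n) (x : 'I_m -> R),
    gopS [eta (fun k => [set a k]) with i |-> hop x] =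
    hop (fun j => gop [eta a with i |-> x j]);
  gop0 : forall (a : 'I_n -> R) (i : 'I_n),
    gop [eta a with i |-> hzero] = hzero }.

Definition krasner_hyperring : Prop := canonical_hypergroup /\ krasner_mult.

Definition gop_commutative : Prop :=
  forall (x : 'I_n -> R) (s : {perm 'I_n}), gop (x \o s) = gop x.

Definition scalar_identity (e : R) : Prop :=
  forall x : R, gop (pad e [:: x]) = x.

Record hyperideal I : Prop := Hyperideal {
  hyperideal_neq0 : I !=set0;
  hyperideal_hop : forall x : 'I_m -> R, box (fun=> I) x -> hop x `<=` I;
  hyperideal_opp : forall x : R, I x -> I (hopp x);
  hyperideal_gop : forall (a : 'I_n -> R) (i : 'I_n),
    gopS [eta (fun k => [set a k]) with i |-> I] `<=` I }.

Definition proper_hyperideal I : Prop := hyperideal I /\ I <> setT.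

Definition prime_hyperideal P : Prop :=
  proper_hyperideal P /\ forall a : 'I_n -> R, P (gop a) -> exists i, P (a i).

Definition radical I : set R :=
  \bigcap_(P in [set P | prime_hyperideal P /\ I `<=` P]) P.

Definition wsq_primary (e : R) P : Prop :=
  proper_hyperideal P /\
  forall r : 'I_n -> R, gop r <> hzero -> P (gop r) ->
    exists i, P (gop (pad e [:: r i; r i])) \/
              radical P (gop [eta r with i |-> e]).

(* f(r, Q, 0^(m-2)) *)
Definition coset Q (r : R) : set R := hopS (pad [set hzero] [:: [set r]; Q]).

Definition cosets Q : Type := {C : set R | range (coset Q) C}.

Definition to_quo Q (r : R) : cosets Q := exist _ (coset Q r) (imageT _ r).

Lemma quo_repr_ex Q (C : cosets Q) : exists r, to_quo Q r = C.
Proof.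
by case: C => C CQ; have [r _ rC] := CQ; exists r; apply: eq_exist.
Qed.

Definition quo_repr Q (C : cosets Q) : R := sval (cid (quo_repr_ex C)).

(* The quotient operations are computed on chosen representatives; by quo_hopE,
   quo_gopE and quo_oppE below the result does not depend on the choice when R
   is a Krasner hyperring and Q is a hyperideal. *)
Definition quo Q : hyperstruct m n := {|
  carrier := cosets Q;
  hop := fun C => to_quo Q @` hop (fun i => quo_repr (C i));
  gop := fun C => to_quo Q (gop (fun i => quo_repr (C i)));
  hzero := to_quo Q hzero;
  hopp := fun C => to_quo Q (hopp (quo_repr C)) |}.

Definition quo_class Q (r : R) : quo Q := to_quo Q r.

Definition quo_set P Q : set (quo Q) := quo_class Q @` P.

End Notions.

Arguments quo_class {m n R} Q r.
Arguments quo_set {m n R} P Q.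

Section Quotient.

Variables (m' n' : nat).
Notation m := m'.+2.
Notation n := n'.+2.
Variable R : hyperstruct m n.
Hypothesis hR : pre_canonical_hypergroup R.
Implicit Types (A B C : set R).

Let z : R := hzero.

Definition hadd A B : set R := hopS (pad [set z] [:: A; B]).

Lemma ext_ord k (a : 'I_k -> R) (i j : 'I_k) : i = j :> nat -> a i = a j.
Proof. by move=> /val_inj ->. Qed.

Lemma nth1 (c : R) k : nth z [:: c] k = if k == 0 then c else z.
Proof. by case: k => //= k; rewrite nth_nil. Qed.

Lemma haddP A B t :
  hadd A B t <-> exists a b, [/\ A a, B b & hop (pad z [:: a; b]) t].
Proof.
split=> [[a Aa at_]|[a [b [Aa Bb abt]]]].
  exists (a ord0), (a (inord 1)); split.
  - exact: (Aa ord0).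
  - by have := Aa (inord 1); rewrite /pad inordK.
  - suff <- : a = pad z [:: a ord0; a (inord 1)] by [].
    apply: funext => i; have := Aa i; rewrite /pad.
    case: i => [[|[|k]] ki] /= Ai; last by move: Ai; rewrite !nth_nil.
      by apply: ext_ord.
    by apply: ext_ord; rewrite /= inordK.
exists (pad z [:: a; b]) => // -[[|[|k]] ki] //=.
by rewrite /pad /= !nth_nil.
Qed.

Lemma hop_perm (s : {perm 'I_m}) (x y : 'I_m -> R) :
  (forall i, y i = x (s i)) -> hop y = hop x.
Proof. by move=> xy; rewrite -(hopC hR x s); congr hop; apply: funext. Qed.

Lemma hop_swap (i j : 'I_m) (x y : 'I_m -> R) :
  y i = x j -> y j = x i -> (forall k, k != i -> k != j -> y k = x k) ->
  hop y = hop x.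
Proof.
move=> yi yj yk; apply: (@hop_perm (tperm i j)) => k.
by case: tpermP => [->|->|/eqP ki /eqP kj] //; apply: yk.
Qed.

Lemma haddC : commutative hadd.
Proof.
have sub A B : hadd A B `<=` hadd B A.
  move=> t /haddP[a [b [Aa Bb abt]]]; apply/haddP; exists b, a; split=> //.
  rewrite -(@hop_swap ord0 (inord 1) (pad z [:: b; a]) (pad z [:: a; b])) //;
    rewrite /pad ?inordK //.
  case=> [[|[|k]] ki] //=; rewrite ?nth_nil //.
  by move=> _ /eqP[]; apply/val_inj; rewrite /= inordK.
by move=> A B; apply/seteqP; split; apply: sub.
Qed.

Lemma hadd0 : right_id [set z] hadd.
Proof.
move=> A; apply/seteqP; split=> [t /haddP[a [b [Aa -> abt]]]|t At].
  suff -> : t = a by [].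
  have : [set a] t; last by [].
  rewrite -(hopx0 hR a); congr (hop _ t): abt.
  by apply: funext => -[[|[|k]] ki]; rewrite /pad //= nth_nil.
apply/haddP; exists t, z; split=> //.
have : [set t] t by [].
rewrite -{1}(hopx0 hR t); congr (hop _ t).
by apply: funext => -[[|[|k]] ki]; rewrite /pad //= nth_nil.
Qed.

Lemma hop0 : hop (fun=> z : R) = [set z].
Proof.
rewrite -(hopx0 hR z); congr hop.
by apply: funext => -[[|k] ki]; rewrite /pad //= nth_nil.
Qed.

Lemma hopA0 (x : nat -> R) (k : nat) (t : R) : k < m ->
  hopS (splice (fun k => [set x k]) 0 (hop (window x 0))) t <->
  hopS (splice (fun k => [set x k]) k (hop (window x k))) t.
Proof. by move=> km; rewrite (hopA hR x ord0 (Ordinal km)). Qed.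

Lemma hopS_splice (x : nat -> R) (k : nat) (C : set R) (t : R) : k < m ->
  hopS (splice (fun k => [set x k]) k C : 'I_m -> set R) t <->
  exists2 c, C c & hop (splice x k c) t.
Proof.
move=> km; split=> [[a Aa at_]|[c Cc ct]].
  exists (a (Ordinal km)).
    by have := Aa (Ordinal km); rewrite /splice /= ltnn eqxx.
  suff <- : a = splice x k (a (Ordinal km)) by [].
  apply: funext => i; have := Aa i; rewrite /splice.
  case: ltnP => // ki; case: eqP => // ik _.
  exact: ext_ord.
exists (splice x k c) => // i.
by rewrite /splice; case: ltnP => // ki; case: eqP.
Qed.

Lemma haddA : associative hadd.
Proof.
have main a b c t : (exists2 s, hop (pad z [:: a; b]) s & hop (pad z [:: s; c]) t)
    <-> (exists2 s, hop (pad z [:: b; c]) s & hop (pad z [:: a; s]) t).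
  pose x i := if i == 0 then a else if i == 1 then b
              else if i == m then c else z.
  have := @hopA0 x 1 t isT; rewrite !hopS_splice //.
  have -> : window x 0 = pad z [:: a; b] :> ('I_m -> R).
    apply: funext => -[[|[|i]] im] //; rewrite /window /pad /x /= nth_nil.
    by rewrite add0n ltn_eqF.
  have -> : hop (window x 1 : 'I_m -> R) = hop (pad z [:: b; c]).
    apply: (@hop_swap (inord 1) ord_max); rewrite /window /pad /x ?inordK //=.
    - by rewrite nth1 add1n !eqSS eq_sym.
    - by rewrite add1n eqxx.
    - case=> [[|[|k]] km] //=.
        by move=> /eqP[]; apply/val_inj; rewrite /= inordK.
      move=> _; rewrite nth_nil -val_eqE /= add1n eqSS => /negPf.
      by rewrite !eqSS => ->.
  have e0 s : splice x 0 s = pad z [:: s; c] :> ('I_m -> R).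
    apply: funext => -[[|[|i]] im] //; rewrite /splice /pad /x /= ?nth_nil //.
    - by rewrite add1n eqxx.
    - by rewrite addSn addnS !eqSS -[X in _ == X]add0n eqn_add2r.
  have e1 s : splice x 1 s = pad z [:: a; s] :> ('I_m -> R).
    apply: funext => -[[|[|i]] im] //; rewrite /splice /pad /x /= ?nth_nil //.
    by rewrite addSn addnS !eqSS -[X in _ == X]add0n eqn_add2r.
  move=> [h1 h2]; split=> -[s s1 s2].
    have [|u u1 u2] := h1; first by exists s => //; rewrite e0.
    by exists u => //; rewrite -e1.
  have [|u u1 u2] := h2; first by exists s => //; rewrite e1.
  by exists u => //; rewrite -e0.
move=> A B C; apply/seteqP; split=> t /haddP.
  move=> [a [s [Aa /haddP[b [c [Bb Cc bcs]]] ast]]].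
  have [_ /(_ (ex_intro2 _ _ s bcs ast))[u u1 u2]] := main a b c t.
  by apply/haddP; exists u, c; split=> //; apply/haddP; exists a, b.
move=> [s [c [/haddP[a [b [Aa Bb abs]]] Cc sct]]].
have [/(_ (ex_intro2 _ _ s abs sct))[u u1 u2] _] := main a b c t.
by apply/haddP; exists a, u; split=> //; apply/haddP; exists b, c.
Qed.

Lemma hadd0l : left_id [set z] hadd.
Proof. by move=> A; rewrite haddC hadd0. Qed.

HB.instance Definition _ :=
  Monoid.isComLaw.Build (set R) [set z] hadd haddA haddC hadd0l.

Lemma hadd1 (a b : R) : hadd [set a] [set b] = hop (pad z [:: a; b]).
Proof.
apply/seteqP; split=> t; first by move=> /haddP[_ [_ [-> ->]]].
by move=> abt; apply/haddP; exists a, b.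
Qed.

Lemma hop_big (x : 'I_m -> R) :
  hop x = \big[hadd/[set z]]_(i < m) [set x i].
Proof.
pose y (i : nat) : R := x (inord i).
have yE (i : 'I_m) : y i = x i by rewrite /y inord_val.
suff H k : k <= m -> hop (fun i : 'I_m => if i < k then y i else z)
    = \big[hadd/[set z]]_(0 <= i < k) [set y i].
  rewrite -(eq_bigr _ (fun i _ => congr1 _ (yE i))) -(big_mkord xpredT (fun i => [set y i])) -H //.
  by congr hop; apply: funext => i; rewrite ltn_ord yE.
elim: k => [_|[_ _|k IH km]]; first by rewrite big_nil hop0.
  rewrite big_nat1 -(hopx0 hR); congr hop.
  by apply: funext => -[[|i] im] //=; rewrite /pad /= nth_nil.
rewrite big_nat_recr //= -IH ?(ltnW km) //.
pose w (i : nat) : R := if i < k.+1 then y i else if i == m then y k.+1 else z.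
have e0 s : splice w 0 s = pad z [:: s; y k.+1] :> ('I_m -> R).
  apply: funext => -[[|[|i]] im] //; rewrite /splice /pad /w /= ?nth_nil //.
    by rewrite add1n !ltnS leqNgt (ltn_trans _ km) //= eqxx.
  rewrite ifN; last by rewrite -leqNgt addSnnS (leq_trans (ltnW km)) ?leq_addl.
  by rewrite addSn addnS !eqSS -[X in _ == X]add0n eqn_add2r.
have e1 : splice w k.+1 (y k.+1) = (fun i : 'I_m => if i < k.+2 then y i else z).
  apply: funext => i; rewrite /splice /w.
  case: (ltngtP i k.+1) => [ik|ki|->]; first by rewrite (ltn_trans ik).
    have -> : (i < k.+2) = false by rewrite ltnS leqNgt ki.
    rewrite ifN.
      by rewrite addnS eqSS -[X in _ == X]/(1 + m') eqn_add2r gtn_eqF // (leq_ltn_trans _ ki).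
    by rewrite -leqNgt (leq_trans (ltnW ki)) ?leq_addr.
  by rewrite ltnSn.
have w0 : window w 0 = (fun i : 'I_m => if i < k.+1 then y i else z).
  apply: funext => i; rewrite /window /w add0n.
  by case: ifP => // _; rewrite ltn_eqF.
have w1 : hop (window w k.+1 : 'I_m -> R) = [set y k.+1].
  rewrite -(hopx0 hR).
  have mk : m - k.+1 < m by rewrite ltn_subrL.
  apply: (@hop_swap ord0 (Ordinal mk)); rewrite /window /w /pad /=.
  - by rewrite addn0 ltnn ltn_eqF // nth1 subn_eq0 leqNgt km.
  - by rewrite subnKC ?(ltnW km) // ltnNge (ltnW km) /= eqxx.
  - case=> [[|i] im] // _; rewrite -val_eqE /= nth_nil => /negPf imk.
    rewrite ifN -?leqNgt ?leq_addr // ifN //.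
    by apply: contraFN imk => /eqP <-; rewrite addKn.
apply/seteqP; split=> t.
- rewrite -e1 => wt; have [_] := hopA0 w t km.
  rewrite !hopS_splice // w1 w0 => -[|s s1 s2]; first by exists (y k.+1).
  by apply/haddP; exists s, (y k.+1); rewrite -e0.
- move=> /haddP[s [_ [s1 -> s2]]]; have [+ _] := hopA0 w t km.
  rewrite !hopS_splice // w1 w0 => -[|_ -> ]; last by rewrite e1.
  by exists s => //; rewrite e0.
Qed.

Lemma hadd_subset A A' B B' : A `<=` A' -> B `<=` B' -> hadd A B `<=` hadd A' B'.
Proof.
move=> AA BB t /haddP[a [b [/AA Aa /BB Bb abt]]].
by apply/haddP; exists a, b.
Qed.

Lemma hopS_pad a A : hopS (pad [set z] [:: [set a]; A]) = hadd [set a] A.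
Proof. by []. Qed.

Lemma hopS_sub (A : 'I_m -> set R) :
  hopS A `<=` \big[hadd/[set z]]_(i < m) A i.
Proof.
move=> t [a Aa]; rewrite hop_big.
elim/big_ind2 : _ t => // [A1 A2 B1 B2|i _ _ ->]; first exact: hadd_subset.
exact: Aa.
Qed.

Variable Q : set R.
Hypothesis hQ : hyperideal Q.

Hypothesis hg : krasner_mult R.

Lemma hyperideal_zero : Q z.
Proof.
have [q Qq] := hyperideal_neq0 hQ.
pose a : 'I_n -> R := [eta (fun=> q) with ord0 |-> z].
have -> : z = gop a by rewrite (gop0 hg).
apply: (hyperideal_gop hQ (a := a) (i := ord_max)); exists a => // i /=.
by case: eqP => // ->.
Qed.

Lemma hadd_ideal : hadd Q Q `<=` Q.
Proof.
move=> t /haddP[a [b [Qa Qb]]]; apply: (hyperideal_hop hQ).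
move=> -[[|[|i]] im]; rewrite /pad //= ?nth_nil //; exact: hyperideal_zero.
Qed.

Lemma big_ideal : \big[hadd/[set z]]_(i < m) Q `<=` Q.
Proof.
elim/big_ind : _ => [_ ->|A B AQ BQ|_ _ t //]; first exact: hyperideal_zero.
by apply: subset_trans hadd_ideal; exact: hadd_subset.
Qed.

Lemma cosetE r : coset Q r = hadd [set r] Q.
Proof. by []. Qed.

Lemma coset_refl r : coset Q r r.
Proof.
rewrite cosetE; apply/haddP; exists r, z; split=> //.
  exact: hyperideal_zero.
have : [set r] r by [].
by rewrite -[X in X r -> _]hadd0 hadd1.
Qed.

Lemma hopp0 : hopp z = z.
Proof.
apply/esym/(hopp_uniq hR); rewrite -hadd1 hadd0 //.
Qed.

Lemma coset_sym r s : coset Q r s -> coset Q s r.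
Proof.
rewrite !cosetE => /haddP[_ [q [-> Qq rqs]]].
apply/haddP; exists s, (hopp q); split=> //; first exact: hyperideal_opp.
have := hop_reversible hR ord0 rqs.
rewrite /pad /=; congr (hop _ _).
apply: funext => -[[|[|i]] im] //=; rewrite ?nth_nil ?hopp0 //.
Qed.

Lemma coset_subset r s : coset Q r s -> coset Q s `<=` coset Q r.
Proof.
rewrite !cosetE => rs t st.
have : hadd (hadd [set r] Q) Q t.
  by apply: hadd_subset st => // _ ->.
rewrite -haddA; apply: hadd_subset => //; exact: hadd_ideal.
Qed.

Lemma coset_eqP r s : coset Q r = coset Q s <-> coset Q r s.
Proof.
split=> [->|rs]; first exact: coset_refl.
by apply/seteqP; split; apply: coset_subset => //; apply: coset_sym.
Qed.

Lemma to_quo_eqP r s : to_quo Q r = to_quo Q s <-> coset Q r s.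
Proof.
rewrite -coset_eqP; split=> [/(congr1 sval)//|rs]; exact: eq_exist.
Qed.

Lemma quo_reprK (C : cosets Q) : to_quo Q (quo_repr C) = C.
Proof. exact: svalP (cid (quo_repr_ex C)). Qed.

Lemma hop_coset (x y : 'I_m -> R) : (forall i, coset Q (x i) (y i)) ->
  to_quo Q @` hop x `<=` to_quo Q @` hop y.
Proof.
move=> xy _ [t xt <-].
have : hadd (\big[hadd/[set z]]_(i < m) [set y i])
            (\big[hadd/[set z]]_(i < m) Q) t.
  rewrite -big_split /=; move: t xt; rewrite hop_big.
  elim/big_ind2 : _ => // [A1 A2 B1 B2|i _]; first exact: hadd_subset.
  by move=> _ ->; apply: coset_sym.
rewrite -hop_big => /haddP[u [q [yu /big_ideal Qq uqt]]].
exists u => //; apply/to_quo_eqP; rewrite cosetE.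
by apply/haddP; exists u, q.
Qed.

Lemma gop_coset1 (a : 'I_n -> R) (i : 'I_n) (s : R) : coset Q (a i) s ->
  coset Q (gop a) (gop [eta a with i |-> s]).
Proof.
rewrite !cosetE => /haddP[_ [q [-> Qq aqs]]].
have : gopS [eta (fun k => [set a k]) with i |-> hop (pad z [:: a i; q])]
            (gop [eta a with i |-> s]).
  by exists [eta a with i |-> s] => // j /=; case: ifP.
rewrite (gopD hg) => H; apply/haddP; exists (gop a), (gop [eta a with i |-> q]).
split=> //.
  apply: (hyperideal_gop hQ (a := a) (i := i)); exists [eta a with i |-> q] => // j /=.
  by case: ifP.
congr (hop _ _): H; apply: funext => -[[|[|j]] jm]; rewrite /pad //= ?nth_nil.
  by congr gop; apply: funext => j /=; case: eqP => // ->.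
exact: (gop0 hg).
Qed.

Lemma gop_coset (x y : 'I_n -> R) : (forall i, coset Q (x i) (y i)) ->
  to_quo Q (gop x) = to_quo Q (gop y).
Proof.
move=> xy; apply/to_quo_eqP.
pose w k (i : 'I_n) := if i < k then y i else x i.
have -> : y = w n by apply: funext => i; rewrite /w ltn_ord.
suff H k : k <= n -> coset Q (gop x) (gop (w k)) by exact: H.
elim: k => [_|k IH kn].
  by have -> : w 0 = x by []; exact: coset_refl.
have := coset_subset (IH (ltnW kn)); apply.
have -> : w k.+1 = [eta w k with Ordinal kn |-> y (Ordinal kn)].
  apply: funext => i; rewrite /w /= -val_eqE /= ltnS leq_eqVlt.
  by case: eqP => //= ik; apply: ext_ord.
by apply: gop_coset1; rewrite /w ltnn.
Qed.

Lemma quo_hopE (x : 'I_m -> R) :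
  hop (fun i => quo_class Q (x i)) = quo_class Q @` hop x.
Proof.
have xE i : coset Q (x i) (quo_repr (to_quo Q (x i))).
  by apply/to_quo_eqP; rewrite quo_reprK.
apply/seteqP; split; apply: hop_coset => i; first exact: coset_sym.
exact: xE.
Qed.

Lemma quo_gopE (x : 'I_n -> R) :
  gop (fun i => quo_class Q (x i)) = quo_class Q (gop x).
Proof.
by apply: gop_coset => i; apply/to_quo_eqP; rewrite quo_reprK.
Qed.

Lemma hadd_opp x : hadd [set x] [set hopp x] z.
Proof. by rewrite hadd1; exact: (hopxN hR). Qed.

Lemma quo_oppE (x : R) : hopp (quo_class Q x) = quo_class Q (hopp x).
Proof.
apply/to_quo_eqP.
set y := quo_repr _.
have /haddP[_ [q [-> Qq yqx]]] : coset Q y x.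
  by apply/to_quo_eqP; rewrite quo_reprK.
apply: coset_sym.
have : hadd (hadd [set y] [set q]) [set hopp x] z.
  by apply: hadd_subset (hadd_opp x) => // _ ->; rewrite hadd1.
rewrite -haddA => /haddP[_ [u [-> qxu /(hopp_uniq hR) <-]]].
by move: qxu; rewrite haddC; apply: hadd_subset => // _ ->.
Qed.

Lemma quo_zeroE : sval (hzero : quo Q) = Q.
Proof.
rewrite /= cosetE -/z haddC hadd0 //.
Qed.

Lemma quo_lift k (C : 'I_k -> quo Q) :
  exists x : 'I_k -> R, C = fun i => quo_class Q (x i).
Proof.
exists (fun i => quo_repr (C i)); apply: funext => i.
exact/esym/quo_reprK.
Qed.

Lemma hopS_quo (A : 'I_m -> set R) :
  hopS (fun j => quo_class Q @` A j) = quo_class Q @` hopS A.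
Proof.
apply/seteqP; split=> t.
  move=> [c cA].
  have [x xc] : {x : 'I_m -> R &
      forall i, A i (x i) /\ quo_class Q (x i) = c i}.
    by apply: (choice (P := fun i y => A i y /\ quo_class Q y = c i)) => i;
      have [y] := cA i; exists y.
  have -> : c = fun i => quo_class Q (x i).
    by apply: funext => i; case: (xc i).
  rewrite quo_hopE => -[u xu <-]; exists u => //; exists x => // i.
  by case: (xc i).
move=> [u [x xA xu] <-]; exists (fun i => quo_class Q (x i)).
  by move=> i; exists (x i).
by rewrite quo_hopE; exists u.
Qed.

Lemma gopS_quo (A : 'I_n -> set R) :
  gopS (fun j => quo_class Q @` A j) = quo_class Q @` gopS A.
Proof.
apply/seteqP; split=> t.
  move=> [c cA].
  have [x xc] : {x : 'I_n -> R &
      forall i, A i (x i) /\ quo_class Q (x i) = c i}.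
    by apply: (choice (P := fun i y => A i y /\ quo_class Q y = c i)) => i;
      have [y] := cA i; exists y.
  have -> : c = fun i => quo_class Q (x i).
    by apply: funext => i; case: (xc i).
  rewrite quo_gopE => <-; exists (gop x) => //; exists x => // i.
  by case: (xc i).
move=> [_ [x xA <-] <-]; exists (fun i => quo_class Q (x i)).
  by move=> i; exists (x i).
by rewrite quo_gopE.
Qed.

Lemma quo_hop (x : 'I_m -> R) (X : 'I_m -> quo Q) :
  (forall i, X i = quo_class Q (x i)) -> hop X = quo_class Q @` hop x.
Proof. by move=> Xx; rewrite -quo_hopE; congr hop; apply: funext. Qed.

Lemma quo_gop (x : 'I_n -> R) (X : 'I_n -> quo Q) :
  (forall i, X i = quo_class Q (x i)) -> gop X = quo_class Q (gop x).
Proof. by move=> Xx; rewrite -quo_gopE; congr gop; apply: funext. Qed.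

Lemma quo_pad k (u : R) (s : seq R) (i : 'I_k) :
  pad (quo_class Q u) (map (quo_class Q) s) i = quo_class Q (pad u s i).
Proof.
rewrite /pad; case: (ltnP i (size s)) => si; first by rewrite (nth_map u).
by rewrite !nth_default ?size_map.
Qed.

Lemma quo_pre_canonical : pre_canonical_hypergroup (quo Q).
Proof.
split.
- move=> X; have [x ->] := quo_lift X; rewrite quo_hopE.
  by have [t xt] := hop_neq0 hR x; exists (quo_class Q t); exists t.
- move=> X i j; pose x k := quo_repr (X k).
  have Xx k : X k = quo_class Q (x k) by exact/esym/quo_reprK.
  have H (l : 'I_m) : hopS (splice (fun k => [set X k]) l (hop (window X l))) =
      quo_class Q @` hopS (splice (fun k => [set x k]) l (hop (window x l))).
    rewrite -hopS_quo; congr hopS; apply: funext => k; rewrite /splice.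
    rewrite (@quo_hop (window x l)); last by move=> ?; exact: Xx.
    by case: ifP => _; [|case: ifP => _] => //; rewrite image_set1 -Xx.
  by rewrite !H (hopA hR x i j).
- move=> X s; have [x ->] := quo_lift X.
  by rewrite (@quo_hop (x \o s)) // (hopC hR) quo_hopE.
- move=> X; rewrite -(quo_reprK X) (quo_hop (quo_pad z [:: _])).
  by rewrite (hopx0 hR) image_set1.
- move=> X; rewrite -(quo_reprK X) quo_oppE (quo_hop (quo_pad z [:: _; _])).
  by exists z => //; exact: (hopxN hR).
- move=> X Y; rewrite -(quo_reprK X) -(quo_reprK Y) quo_oppE.
  set x := quo_repr X; set y := quo_repr Y.
  rewrite (quo_hop (quo_pad z [:: x; y])) => -[q].
  rewrite -hadd1 => xyq /to_quo_eqP/coset_sym; rewrite cosetE -/z haddC hadd0.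
  move=> Qq; apply/to_quo_eqP/coset_sym; rewrite cosetE.
  apply/haddP; exists (hopp x), q; split=> //.
  move: xyq; rewrite hadd1 => /(hop_reversible hR (inord 1)).
  rewrite [X in hop _ X]/pad inordK //=; congr (hop _ y).
  apply: funext => -[[|[|i]] im]; rewrite /= -val_eqE /= inordK /pad //=.
  by rewrite !nth_nil hopp0.
- move=> X Y i; have [x ->] := quo_lift X; rewrite quo_hopE => -[t xt <-].
  rewrite (@quo_hop [eta (fun j => hopp (x j)) with i |-> t]).
    by exists (x i) => //; exact: (hop_reversible hR).
  by move=> j /=; case: ifP => // _; exact: quo_oppE.
Qed.

Lemma quo_krasner_mult : krasner_mult (quo Q).
Proof.
split.
- move=> X i j; pose x k := quo_repr (X k).
  have Xx k : X k = quo_class Q (x k) by exact/esym/quo_reprK.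
  have H (l : 'I_n) : gop (splice X l (gop (window X l))) =
      quo_class Q (gop (splice x l (gop (window x l)))).
    apply: quo_gop => k; rewrite /splice.
    rewrite (@quo_gop (window x l)); last by move=> ?; exact: Xx.
    by case: ifP => _; [|case: ifP => _].
  by rewrite !H (gopA hg x i j).
- move=> C i X; have [c ->] := quo_lift C; have [x ->] := quo_lift X.
  rewrite [RHS](@quo_hop (fun j => gop [eta c with i |-> x j])).
    rewrite -(gopD hg) -gopS_quo; congr gopS; apply: funext => k /=.
    by case: ifP => _; [exact: quo_hopE|rewrite image_set1].
  by move=> j; apply: quo_gop => k /=; case: ifP.
- move=> C i; have [c ->] := quo_lift C.
  by rewrite (@quo_gop [eta c with i |-> z]) ?(gop0 hg) // => k /=; case: ifP.
Qed.

End Quotient.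

(* Main.v *)
Require Import Defs.
From mathcomp Require Import all_boot perm.
From mathcomp Require Import boolp classical_sets.

Local Open Scope classical_set_scope.

(** Everything rests on the correspondence between the hyperideals of R that
    contain Q and the hyperideals of R/Q.  A hyperideal I containing Q is a
    union of cosets of Q, so it is recovered from its image: x lies in I as soon
    as its class lies in I/Q ([quo_setE]).  Images of primes containing Q and
    preimages of primes are therefore again prime ([prime_quo_set],
    [prime_preimage]), whence the radical of P/Q pulls back to the radical of P
    ([radical_quo]).

    Since g commutes with the projection, the conclusion of the wsq-primary
    condition for P at r is then equivalent to that for P/Q at the class of r
    ([wsq_conclusion_quo]).  The two conditions differ only in their hypothesis:
    the class of g(r) is nonzero exactly when g(r) lies outside Q.  This is
    stronger than g(r) being nonzero, which gives (1).  For (2), the tuples with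
    g(r) nonzero but in Q are the ones that the condition on Q handles, because
    Q and its radical are contained in P and its radical. *)

Section Correspondence.

Local Set Implicit Arguments.
Local Unset Strict Implicit.

Variables (m n : nat) (R : hyperstruct m.+2 n.+2).
Hypothesis hR : pre_canonical_hypergroup R.
Hypothesis hg : krasner_mult R.
Variable Q : set R.
Hypothesis hQ : hyperideal Q.
Implicit Types (I P : set R) (J : set (quo Q)).

(** A hyperideal containing Q is stable under translation by Q, hence a union
    of cosets. *)
Lemma quo_setE I (x : R) : hyperideal I -> Q `<=` I ->
  quo_set I Q (quo_class Q x) <-> I x.
Proof.
move=> hI QI; split=> [[p Ip /(to_quo_eqP hR hQ hg)]|Ix]; last by exists x.
rewrite cosetE => /haddP[_ [q [-> /QI Iq pqx]]].
apply: (hyperideal_hop hI) pqx => i; rewrite /pad.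
case: i => -[|[|i]] im //=; rewrite nth_nil.
exact: (hyperideal_zero hI hg).
Qed.

Lemma quo_class_eq0 (x : R) : quo_class Q x = hzero <-> Q x.
Proof.
split=> [/esym/(to_quo_eqP hR hQ hg)|Qx].
  by rewrite cosetE (hadd0l hR).
by apply/esym/(to_quo_eqP hR hQ hg); rewrite cosetE (hadd0l hR).
Qed.

Lemma hyperideal_quo_set I : hyperideal I -> hyperideal (quo_set I Q).
Proof.
move=> hI; split.
- by have [x Ix] := hyperideal_neq0 hI; exists (quo_class Q x), x.
- move=> X IX.
  have [x xX] : {x : 'I_m.+2 -> R & forall i, I (x i) /\ quo_class Q (x i) = X i}.
    by apply: (choice (P := fun i y => I y /\ quo_class Q y = X i)) => i;
      have [y] := IX i; exists y.
  rewrite (quo_hop hR hQ hg (x := x)) => [|i]; last by case: (xX i).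
  move=> _ [t xt <-]; exists t => //.
  by apply: (hyperideal_hop hI) xt => i; case: (xX i).
- move=> _ [x Ix <-]; rewrite (quo_oppE hR hQ hg); exists (hopp x) => //.
  exact: (hyperideal_opp hI).
- move=> A i; have [a ->] := quo_lift A.
  have -> : ([eta (fun k => [set quo_class Q (a k)]) with i |-> quo_set I Q]
        : 'I_n.+2 -> set (quo Q)) =
      (fun k => quo_class Q @` [eta (fun k => [set a k]) with i |-> I] k).
    by apply: funext => k /=; case: ifP => // _; rewrite image_set1.
  rewrite (gopS_quo hR hQ hg); apply: image_subset.
  exact: (hyperideal_gop hI).
Qed.

Lemma hyperideal_preimage J :
  hyperideal J -> hyperideal (quo_class Q @^-1` J).
Proof.
move=> hJ; split.
- have [X JX] := hyperideal_neq0 hJ; exists (quo_repr X).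
  by rewrite /preimage /= /quo_class quo_reprK.
- move=> x Jx t xt.
  apply: (hyperideal_hop hJ (x := fun i => quo_class Q (x i))); first exact: Jx.
  by rewrite (quo_hopE hR hQ hg); exists t.
- by move=> x Jx; rewrite /preimage /= -(quo_oppE hR hQ hg);
    apply: (hyperideal_opp hJ).
- move=> a i _ [b ab <-]; rewrite /preimage /= -(quo_gopE hR hQ hg).
  apply: (hyperideal_gop hJ (a := fun k => quo_class Q (a k)) (i := i)).
  exists (fun k => quo_class Q (b k)) => // k.
  by have := ab k => /=; case: ifP => // _ ->.
Qed.

Lemma proper_quo_set I : proper_hyperideal I -> Q `<=` I ->
  proper_hyperideal (quo_set I Q).
Proof.
move=> [hI IT] QI; split=> [|QT]; first exact: hyperideal_quo_set.
by apply: IT; apply/seteqP; split=> // x _; apply/(quo_setE x hI QI); rewrite QT.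
Qed.

Lemma proper_preimage J :
  proper_hyperideal J -> proper_hyperideal (quo_class Q @^-1` J).
Proof.
move=> [hJ JT]; split=> [|JT']; first exact: hyperideal_preimage.
apply: JT; apply/seteqP; split=> // X _; rewrite -(quo_reprK X).
have : (quo_class Q @^-1` J) (quo_repr X) by rewrite JT'.
by [].
Qed.

Lemma prime_quo_set P : prime_hyperideal P -> Q `<=` P ->
  prime_hyperideal (quo_set P Q).
Proof.
move=> [hP primeP] QP; split=> [|A]; first exact: proper_quo_set.
have [a ->] := quo_lift A; rewrite (quo_gopE hR hQ hg).
move=> /(quo_setE _ (proj1 hP) QP)/primeP[i Pai].
by exists i; apply/(quo_setE _ (proj1 hP) QP).
Qed.

Lemma prime_preimage J :
  prime_hyperideal J -> prime_hyperideal (quo_class Q @^-1` J).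
Proof.
move=> [hJ primeJ]; split=> [|a]; first exact: proper_preimage.
by rewrite /preimage /= -(quo_gopE hR hQ hg) => /primeJ.
Qed.

(** The primes over P/Q and the primes over P correspond under image and
    preimage, so membership in all of the former is membership in all of the
    latter. *)
Lemma radical_quo P (x : R) : Q `<=` P ->
  radical (quo_set P Q) (quo_class Q x) <-> radical P x.
Proof.
move=> QP; split=> [radx I [primeI PI]|radx J [primeJ PJ]].
  have QI : Q `<=` I by exact: subset_trans PI.
  apply/(quo_setE x (proj1 (proj1 primeI)) QI); apply: radx; split.
    exact: prime_quo_set.
  exact: image_subset.
apply: (radx (quo_class Q @^-1` J)); split; first exact: prime_preimage.
by move=> y Py; apply: PJ; exists y.
Qed.

Lemma wsq_conclusion_quo (e : R) P (r : 'I_n.+2 -> R) (i : 'I_n.+2) :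
  hyperideal P -> Q `<=` P ->
  quo_set P Q (gop (pad (quo_class Q e) [:: quo_class Q (r i); quo_class Q (r i)]))
    \/ radical (quo_set P Q)
         (gop [eta (fun k => quo_class Q (r k)) with i |-> quo_class Q e])
  <-> P (gop (pad e [:: r i; r i])) \/ radical P (gop [eta r with i |-> e]).
Proof.
move=> hP QP.
rewrite (quo_gop hR hQ hg (quo_pad Q e [:: r i; r i])).
rewrite (quo_gop hR hQ hg (x := [eta r with i |-> e])) => [|k /=]; last first.
  by case: ifP.
by rewrite quo_setE // radical_quo.
Qed.

Lemma wsq_primary_quo (e : R) P : Q `<=` P ->
  wsq_primary e P -> wsq_primary (quo_class Q e) (quo_set P Q).
Proof.
move=> QP [hP wsqP]; split=> [|A]; first exact: proper_quo_set.
have [r ->] := quo_lift A; rewrite (quo_gopE hR hQ hg).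
move=> gr0 /(quo_setE _ (proj1 hP) QP) Pgr.
have [|i ri] := wsqP r _ Pgr; last first.
  by exists i; apply/(wsq_conclusion_quo _ _ _ (proj1 hP) QP).
move=> gr; apply: gr0; apply/quo_class_eq0; rewrite gr.
exact: (hyperideal_zero hQ hg).
Qed.

Lemma radicalS (I P : set R) : I `<=` P -> radical I `<=` radical P.
Proof.
by move=> IP x Ix J [primeJ PJ]; apply: Ix; split=> //; exact: subset_trans PJ.
Qed.

Lemma wsq_primary_of_quo (e : R) P : proper_hyperideal P -> Q `<=` P ->
  wsq_primary e Q -> wsq_primary (quo_class Q e) (quo_set P Q) ->
  wsq_primary e P.
Proof.
move=> hP QP [_ wsqQ] [_ wsqPQ]; split=> // r gr0 Pgr.
have [Qgr|nQgr] := pselect (Q (gop r)).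
  have [i [Qri|radri]] := wsqQ r gr0 Qgr; exists i; first by left; apply: QP.
  by right; apply: (radicalS QP).
have [||i ri] := wsqPQ (fun k => quo_class Q (r k)).
- by rewrite (quo_gopE hR hQ hg) => /quo_class_eq0.
- by rewrite (quo_gopE hR hQ hg); apply/(quo_setE _ (proj1 hP) QP).
- by exists i; apply/(wsq_conclusion_quo _ _ _ (proj1 hP) QP).
Qed.

End Correspondence.

Theorem corollary4p12 (m n : nat) (hm : 2 <= m) (hn : 2 <= n)
    (R : hyperstruct m n) (hR : krasner_hyperring R) (hC : gop_commutative R)
    (e : R) (he : scalar_identity e) (he0 : e <> hzero)
    (P Q : set R) (hP : proper_hyperideal P) (hQ : proper_hyperideal Q)
    (hQP : Q `<=` P) :
  (wsq_primary e P -> wsq_primary (quo_class Q e) (quo_set P Q)) /\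
  (wsq_primary e Q -> wsq_primary (quo_class Q e) (quo_set P Q) ->
   wsq_primary e P).
Proof.
case: m hm R hR hC e he he0 P Q hP hQ hQP => [|[|m]] // _.
case: n hn => [|[|n]] // _ R [[hR _] hg] _ e _ _ P Q hP [hQ _] QP.
by split; [exact: wsq_primary_quo | exact: wsq_primary_of_quo].
Qed.
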